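(* Let $T:\mathcal H\rightrightarrows\mathcal H$ be maximal monotone and suppose $\operatorname{gph}T_*\neq\emptyset$. Let $\widetilde T$ be the partial inverse of $T$ with respect to $H_*\oplus H_{**}$, let $D:=\operatorname{cl}(\operatorname{dom}\widetilde T)$, which is nonempty, closed and convex, and define $$K_{**}:=\{q_{**}\in H_{**}\mid\langle(0,q_{**}),y\rangle\le0\ \ \forall\,y\in D\}.$$ Then $K_{**}$ is a nonempty closed convex cone, and for all $(z_*,w_* )\in\operatorname{gph}T_*$, the set $T_{**}(z_*,w_* )$ is nonempty, closed and convex, and $$\operatorname{rec}T_{**}(z_*,w_* )=\{q_{**}\in H_{**}\mid(0,q_{**})\in N_D(z_*,0)\}=K_{**}.$$ Consequently, one completion fiber is bounded if and only if every completion fiber is bounded. In that case every completion fiber is compact.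
   Context: $\mathcal H$ is a finite-dimensional Hilbert space with an orthogonal decomposition $\mathcal H=H_*\oplus H_{**}$ into subspaces; each $z\in\mathcal H$ is written $z=(z_*,z_{**})$ with $z_*\in H_*$, $z_{**}\in H_{**}$ its orthogonal components. The projected mapping $T_*:H_*\rightrightarrows H_*$ and the completion mapping $T_{**}:H_*\times H_*\rightrightarrows H_{**}$ are defined by $$w_*\in T_*(z_* )\iff\exists z_{**}\in H_{**}\text{ such that }(w_*,0)\in T(z_*,z_{**}),$$ $$T_{**}(z_*,w_* ):=\{z_{**}\in H_{**}\mid(w_*,0)\in T(z_*,z_{**})\}.$$ The completion fibers are the sets $T_{**}(z_*,w_* )$ with $(z_*,w_* )\in\operatorname{gph}T_*$ (note $\operatorname{dom}T_{**}=\operatorname{gph}T_*$). The partial inverse $\widetilde T:\mathcal H\rightrightarrows\mathcal H$ is defined by $$(w_*,z_{**})\in\widetilde T(z_*,w_{**})\iff(w_*,w_{**})\in T(z_*,z_{**}).$$ For a nonempty closed convex set $C\subset\mathcal H$, the recession cone is $\operatorname{rec}C:=\{d\mid C+td\subset C\ \forall t\ge0\}$, and $N_C$ denotes the normal cone mapping of convex analysis. *)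

(* Defs.v *)
From HB Require Import structures.
From mathcomp Require Import all_boot all_order all_algebra.
From mathcomp Require Import all_classical all_reals all_analysis.

Set Implicit Arguments.
Unset Strict Implicit.
Unset Printing Implicit Defensive.

Import Order.TTheory GRing.Theory Num.Theory.
Import numFieldNormedType.Exports.

Local Open Scope classical_set_scope.
Local Open Scope ring_scope.

(* A vectType is finite-dimensional, so completeness need not be required. *)
HB.mixin Record isFinDimHilbert (R : realType) H
    of NormedModule R H & Vector R H := {
  inner : {dot H for idfun} ;
  inner_norm : forall x : H, inner x x = `|x| ^+ 2
}.

#[short(type="finDimHilbertType")]
HB.structure Definition FinDimHilbert (R : realType) :=
  {H of isFinDimHilbert R H & NormedModule R H & Vector R H}.

(* Set-valued mappings H => H are functions F : H -> set H. *)
Section SetValued.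
Context {R : realType} {H : finDimHilbertType R}.
Implicit Types (F : H -> set H) (C : set H).

Definition gph F : set (H * H) := [set p | F p.1 p.2].

Definition dom F : set H := [set x | F x !=set0].

Definition monotone F :=
  forall x y u v, F x u -> F y v -> 0 <= inner (u - v) (x - y).

Definition maximal_monotone F :=
  monotone F /\
  forall G : H -> set H, monotone G -> gph F `<=` gph G -> gph G = gph F.

Definition recession C : set H :=
  [set d | forall (t : R) x, 0 <= t -> C x -> C (x + t *: d)].

Definition normal_cone C : H -> set H :=
  fun x => [set v | C x /\ forall y, C y -> inner v (y - x) <= 0].

Definition cone C := forall (t : R) x, 0 <= t -> C x -> C (t *: x).

End SetValued.

(* Hs and Hss are the summands of the orthogonal decomposition.  A pair
   (zs, zss) in Hs x Hss is encoded as the sum zs + zss in H; in particular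
   (zs, 0) is zs and (0, zss) is zss. *)
Section Splitting.
Context {R : realType} {H : finDimHilbertType R}.
Variables Hs Hss : {vspace H}.

Definition orthogonal_decomposition :=
  (Hs + Hss)%VS = fullv /\
  forall x y, x \in Hs -> y \in Hss -> inner x y = 0.

Variable T : H -> set H.

Definition projected : H -> set H :=
  fun zs => [set ws | [/\ zs \in Hs, ws \in Hs
                        & exists2 zss, zss \in Hss & T (zs + zss) ws]].

Definition completion (zs ws : H) : set H :=
  [set zss | [/\ zs \in Hs, ws \in Hs, zss \in Hss & T (zs + zss) ws]].

Definition partial_inverse : H -> set H :=
  fun v => [set u | exists zs ws zss wss : H,
    [/\ zs \in Hs, ws \in Hs, zss \in Hss & wss \in Hss] /\
    [/\ v = zs + wss, u = ws + zss & T (zs + zss) (ws + wss)]].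

End Splitting.

(* Main.v *)
(* For the partial inverse S of T, a fiber consists of the q in Hss with
   ws + q in S(zs), and S is again maximal monotone because exchanging the
   Hss-components preserves <u - v, x - y>.  Maximality of T writes the fiber
   as an intersection of half-spaces, whose recession cone is the intersection
   of the homogenized half-spaces; this does not depend on (zs, ws) and is K.
   By Bolzano-Weierstrass, such an intersection is bounded iff its recession
   cone is {0}.
   Convexity of cl(dom S) rests on Minty's theorem: for x in the convex hull of
   dom S, the resolvents (I + l S)^-1 x lie in dom S and tend to x as l -> 0.
   Minty's theorem is obtained by maximizing the strongly concave function
   -c - |y - y'|^2 / 4 over a convex set of triples (y, y', c) that contains
   all (y, y', <y, y'>) with (y, y') in the graph and on which <y, y'> <= c. *)

Require Import Defs.
From HB Require Import structures.
From mathcomp Require Import all_boot all_order all_algebra.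
From mathcomp Require Import all_classical all_reals all_analysis.
From mathcomp Require Import ring lra.

Set Implicit Arguments.
Unset Strict Implicit.
Unset Printing Implicit Defensive.

Import Order.TTheory GRing.Theory Num.Theory.
Import numFieldNormedType.Exports.

Local Open Scope classical_set_scope.
Local Open Scope ring_scope.

(** * The inner product and the Cauchy-Schwarz inequality *)

Section Inner.
Context {R : realType} {H : finDimHilbertType R}.
Implicit Types x y z : H.

Lemma innerC x y : inner x y = inner y x.
Proof. by rewrite (hermC inner x y) expr0 mul1r. Qed.

Lemma innerDl x y z : inner (x + y) z = inner x z + inner y z.
Proof. by rewrite linearDl. Qed.

Lemma innerZl a x z : inner (a *: x) z = a * inner x z.
Proof. by rewrite linearZl_LR. Qed.

Lemma innerNl x z : inner (- x) z = - inner x z.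
Proof. by rewrite linearNl. Qed.

Lemma innerDr z x y : inner z (x + y) = inner z x + inner z y.
Proof. by rewrite innerC innerDl (innerC x) (innerC y). Qed.

Lemma innerZr a z x : inner z (a *: x) = a * inner z x.
Proof. by rewrite innerC innerZl (innerC x). Qed.

Lemma innerNr z x : inner z (- x) = - inner z x.
Proof. by rewrite innerC innerNl (innerC x). Qed.

Lemma inner0r x : inner x 0 = 0.
Proof. by rewrite -(scale0r x) innerZr mul0r. Qed.

Definition innerE := (innerDl, innerDr, innerZl, innerZr, innerNl, innerNr).

Lemma inner_ge0 x : 0 <= inner x x.
Proof. by rewrite inner_norm sqr_ge0. Qed.

Lemma cauchy_schwarz x y : `|inner x y| <= `|x| * `|y|.
Proof.
have [->|y0] := eqVneq y 0; first by rewrite inner0r !normr0 mulr0.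
have yy : 0 < `|y| by rewrite normr_gt0.
have := inner_ge0 (`|y| ^+ 2 *: x - inner x y *: y).
rewrite !innerE (innerC y x) !inner_norm => h.
have {}h : 0 <= `|y| ^+ 2 * ((`|x| * `|y|) ^+ 2 - inner x y ^+ 2) by nra.
rewrite pmulr_rge0 ?exprn_gt0// subr_ge0 in h.
by rewrite -(ler_sqr _ _) ?nnegrE ?mulr_ge0// real_normK// num_real.
Qed.

End Inner.

(** * Compactness in finite dimension, through coordinates *)

Section HeineBorel.
Context {R : realType} {H : finDimHilbertType R}.
Implicit Types (x y : H) (A : set H).
Import VectorInternalTheory.

Lemma r2v_continuous : continuous (r2v : 'rV[R]_(dim H) -> H).
Proof.
have -> : (r2v : 'rV[R]_(dim H) -> H) =
    fun u => \sum_j u ord0 j *: r2v (delta_mx ord0 j).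
  apply/funext => u; rewrite {1}[u]row_sum_delta linear_sum /=.
  by apply: eq_bigr => j _; rewrite linearZ.
move=> u; apply: (cvg_big add_continuous (nbhs_filter u)) => j _.
have cj : {for u, continuous (fun u : 'rV[R]_(dim H) => u ord0 j)}.
  exact: coord_continuous.
exact: (continuous_comp cj (@scalel_continuous _ _ _ _)).
Qed.

(** Equivalence of norms: the minimum over the unit sphere of row vectors is positive because [r2v]
    is injective, and homogeneity does the rest. *)
Lemma r2v_norm_lbound :
  exists2 c : R, 0 < c & forall u : 'rV[R]_(dim H), c * `|u| <= `|r2v u : H|.
Proof.
pose S := [set u : 'rV[R]_(dim H) | `|u| = 1].
have scale (u : 'rV[R]_(dim H)) : u != 0 -> S (`|u|^-1 *: u).
  by move=> u0; rewrite /S /= normrZ normfV normr_id mulVf// normr_eq0.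
(* In dimension 0 the sphere [S] is empty and any constant works. *)
have [[s Ss]|S0] := pselect (S !=set0); last first.
  exists 1 => // u; have [->|/scale Su] := eqVneq u 0.
    by rewrite normr0 mulr0.
  by exfalso; apply: S0; eexists; exact: Su.
have cS : compact S.
  apply: bounded_closed_compact.
    by exists 1; split=> // M M1 u /= ->; exact: ltW.
  have -> : S = (fun u => `|u|) @^-1` [set 1] by [].
  by apply: closed_comp => // u _; exact: norm_continuous.
have cf : {within S, continuous (fun u : 'rV[R]_(dim H) => `|r2v u : H|)}.
  apply: continuous_subspaceT => u.
  exact: continuous_comp (@r2v_continuous u) (@norm_continuous _ _ _).
have [c + cmin] := compact_EVT_min (ex_intro _ s Ss) cS cf.
rewrite inE => Sc; exists `|r2v c : H|.
  rewrite normr_gt0; apply/negP => /eqP c0.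
  have : c = 0 by apply: (@r2v_inj _ H); rewrite c0 linear0.
  move=> c00; move: Sc; rewrite /S /= c00 normr0 => /eqP.
  by rewrite eq_sym oner_eq0.
move=> u; have [->|u0] := eqVneq u 0; first by rewrite normr0 mulr0.
have := cmin (`|u|^-1 *: u); rewrite inE => /(_ (scale _ u0)).
rewrite linearZ /= normrZ normfV normr_id => h.
by rewrite -ler_pdivlMr ?normr_gt0// mulrC.
Qed.

(** [A] is the image under the continuous [r2v] of its preimage, which [r2v_norm_lbound] shows to be
    bounded. *)
Lemma bounded_closed_compact_hilbert A : bounded_set A -> closed A -> compact A.
Proof.
move=> bA cA.
have -> : A = r2v @` (r2v @^-1` A).
  apply/seteqP; split=> [x Ax|_ [u Au <-]//].
  by exists (v2r x); rewrite /= v2rK.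
apply: continuous_compact.
  by apply: continuous_subspaceT; exact: r2v_continuous.
apply: bounded_closed_compact; last first.
  by apply: closed_comp => // u _; exact: r2v_continuous.
have [c c0 hc] := r2v_norm_lbound.
have [M [Mr hM]] := bA.
exists ((`|M| + 1) / c); split; first exact: num_real.
move=> N hN u /= Au.
have := hM (`|M| + 1) _ _ Au.
rewrite (le_lt_trans (ler_norm M)) ?ltrDl// => /(_ isT) /= hu.
apply: le_trans (ltW hN); rewrite ler_pdivlMr// mulrC.
exact: le_trans hu.
Qed.

Lemma closure_ballP A x :
  closure A x <-> forall e, 0 < e -> exists2 y, A y & `|x - y| < e.
Proof.
split=> [cAx e e0|h].
  have [y [Ay]] := cAx _ (nbhsx_ballx x e e0).
  by rewrite -ball_normE /= => xy; exists y.
move=> B /nbhs_ballP[e /= e0 eB]; have [y Ay xy] := h e e0.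
by exists y; split=> //; apply: eB; rewrite -ball_normE.
Qed.

(* Bolzano-Weierstrass, phrased so that no subsequence has to be extracted. *)
Lemma bounded_seq_cluster (u : nat -> H) (M : R) : (forall n, `|u n| <= M) ->
  exists x, forall A, closed A -> (\forall n \near \oo, A (u n)) -> A x.
Proof.
move=> uM.
pose B := [set x : H | `|x| <= M].
have cB : compact B.
  apply: bounded_closed_compact_hilbert.
    exists M; split; first exact: num_real.
    by move=> N MN x /= xM; exact: le_trans xM (ltW MN).
  have -> : B = (fun x : H => `|x|) @^-1` [set r | r <= M] by [].
  by apply: closed_comp => [x _|]; [exact: norm_continuous|exact: closed_le].
have [|x [_ clx]] := cB (u @ \oo) _.
  by exists 0 => // n _; exact: uM.
exists x => A cA Au; apply: cA => V Vx.
by have := clx A V Au Vx.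
Qed.

Lemma inner_continuousr (p : H) : continuous (inner p : H -> R).
Proof.
move=> x; apply/cvgrPdist_le => e e0.
near=> y.
rewrite -innerNr -innerDr (le_trans (cauchy_schwarz _ _))//.
have : `|x - y| <= e / (`|p| + 1).
  near: y; apply: cvgr_dist_le; first exact: cvg_id.
  by rewrite divr_gt0// ltr_wpDl.
rewrite ler_pdivlMr ?ltr_wpDl// => h.
by apply: le_trans h; rewrite mulrC ler_wpM2l// lerDl.
Unshelve. all: by end_near. Qed.

End HeineBorel.

(** * Convexity of closures, and intersections of half-spaces *)

Section Convexity.
Context {R : realType} {H : finDimHilbertType R}.
Implicit Types (x y : H) (A : set H) (P : set (H * R)).

Lemma convex_setP A :
  (forall x y (t : R), 0 <= t -> t <= 1 -> A x -> A y ->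
    A (t *: x + (1 - t) *: y)) -> convex_set A.
Proof.
move=> cA x y t; rewrite !inE => Ax Ay.
exact: (cA x y t%:num).
Qed.

(** Asking for combinations in the closure only suits approximation by resolvents; idempotence of
    the closure makes it enough. *)
Lemma closure_convex A :
  (forall x y (t : R), 0 <= t -> t <= 1 -> A x -> A y ->
    closure A (t *: x + (1 - t) *: y)) -> convex_set (closure A).
Proof.
move=> cA; apply: convex_setP => x y t t0 t1 Ax Ay.
have /closure_id -> : closed (closure A) by exact: closed_closure.
apply/closure_ballP => e e0.
have /closure_ballP/(_ e e0)[x' Ax' xx'] := Ax.
have /closure_ballP/(_ e e0)[y' Ay' yy'] := Ay.
exists (t *: x' + (1 - t) *: y'); first exact: cA.
have -> : t *: x + (1 - t) *: y - (t *: x' + (1 - t) *: y') =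
    t *: (x - x') + (1 - t) *: (y - y').
  by rewrite !scalerBr opprD addrACA.
apply: le_lt_trans (ler_normD _ _) _; rewrite !normrZ !ger0_norm ?subr_ge0//.
(* The strict bound comes from the [x] term, so [t = 0] is treated apart. *)
have [->|t_neq0] := eqVneq t 0; first by rewrite mul0r add0r subr0 mul1r.
have tgt0 : 0 < t by rewrite lt0r t_neq0.
have : t * `|x - x'| < t * e by rewrite ltr_pM2l.
have : (1 - t) * `|y - y'| <= (1 - t) * e by rewrite ler_wpM2l ?subr_ge0// ltW.
lra.
Qed.

(** Both the fibers and [K] are put in this form, which yields their closedness and convexity at
    once. *)
Definition halfspaces P : set H :=
  [set q | forall p b, P (p, b) -> inner p q <= b].

Lemma closed_halfspaces P : closed (halfspaces P).
Proof.
have -> : halfspaces P =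
    \bigcap_(pb in P) (inner pb.1 @^-1` [set r | r <= pb.2]).
  apply/seteqP; split=> q /= hq; first by case=> p b /=; exact: hq.
  by move=> p b /hq.
apply: closed_bigI => pb _; apply: closed_comp; last exact: closed_le.
by move=> x _; exact: inner_continuousr.
Qed.

Lemma convex_halfspaces P : convex_set (halfspaces P).
Proof.
apply: convex_setP => x y t t0 t1 hx hy p b Ppb.
have := ler_wpM2l t0 (hx p b Ppb).
have := ler_wpM2l (etrans (subr_ge0 _ _) t1) (hy p b Ppb).
rewrite !innerE; lra.
Qed.

Definition homogenize P : set (H * R) :=
  [set p0 | p0.2 = 0 /\ exists b, P (p0.1, b)].

Lemma recession_halfspaces P : halfspaces P !=set0 ->
  recession (halfspaces P) = halfspaces (homogenize P).
Proof.
move=> [x hx]; apply/seteqP; split=> d /= hd.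
  move=> p _ [/= -> [b Ppb]]; rewrite leNgt; apply/negP => pd.
  (* This step length makes [<p, x + t d>] equal to [b + 1]. *)
  have t0 : 0 <= (b - inner p x + 1) / inner p d.
    by rewrite divr_ge0// ?(ltW pd)// addr_ge0// subr_ge0 hx.
  have := hd _ x t0 hx p b Ppb; rewrite !innerE divfK ?gt_eqF//; lra.
move=> t y t0 hy p b Ppb.
have /(ler_wpM2l t0) : inner p d <= 0 by apply: hd; split=> //; exists b.
have := hy p b Ppb; rewrite !innerE; lra.
Qed.

Lemma inner_eq0 x : inner x x <= 0 -> x = 0.
Proof.
by rewrite inner_norm le_eqVlt ltNge sqr_ge0 orbF sqrf_eq0 normr_eq0 => /eqP.
Qed.

Lemma bounded_setP A :
  bounded_set A <-> exists M : R, forall x, A x -> `|x| <= M.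
Proof.
split=> [[M [_ hM]]|[M hM]].
  by exists (M + 1) => x Ax; apply: hM => //; rewrite ltrDl.
exists M; split; first exact: num_real.
by move=> N MN x Ax /=; exact: le_trans (hM _ Ax) (ltW MN).
Qed.

(** In the unbounded case, points [u n] of norm above [n] are normalized and cluster at a unit
    vector [d]; dividing each constraint by [|u n|] makes its bound vanish in the limit, so [d] is a
    recession direction. *)
Lemma bounded_halfspacesP P : halfspaces P !=set0 ->
  bounded_set (halfspaces P) <-> recession (halfspaces P) `<=` [set 0].
Proof.
move=> P0; have [x0 hx0] := P0; split=> [/bounded_setP[M hM] d rd|].
  apply: contrapT => /eqP; rewrite -normr_gt0 => d0.
  have M0 : 0 <= M + `|x0| + 1.
    by rewrite !addr_ge0// (le_trans _ (hM _ hx0)).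
  have := hM _ (rd ((M + `|x0| + 1) / `|d|) x0 (divr_ge0 M0 (ltW d0)) hx0).
  set t := _ / _ => h.
  have : `|t *: d| <= M + `|x0|.
    rewrite -[t *: d](addKr x0) (le_trans (ler_normD _ _))// normrN addrC.
    by rewrite lerD.
  rewrite normrZ ger0_norm ?divr_ge0// ?(ltW d0)// /t divfK ?gt_eqF//; lra.
rewrite recession_halfspaces// => rec0; apply: contrapT => /bounded_setP nb.
have /choice[u hu] : forall n : nat, exists x, halfspaces P x /\ n%:R < `|x|.
  move=> n; apply: contrapT => h; apply: nb; exists n%:R => x hx.
  by rewrite leNgt; apply/negP => nx; apply: h; exists x.
have u0 n : 0 < `|u n| by apply: le_lt_trans (hu n).2.
have u1 n : `| `|u n|^-1 *: u n| = 1.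
  by rewrite normrZ normfV normr_id mulVf// gt_eqF.
have [d hd] : exists d, forall A, closed A ->
    (\forall n \near \oo, A (`|u n|^-1 *: u n)) -> A d.
  by apply: (@bounded_seq_cluster _ _ _ 1) => n; rewrite u1.
have d1 : `|d| = 1.
  have -> : (`|d| = 1) = ((fun x : H => `|x|) @^-1` [set 1]) d by [].
  apply: hd.
    by apply: closed_comp => // x _; exact: norm_continuous.
  by exists 0 => // n _ /=; rewrite u1.
have : d = 0.
  apply: rec0 => p _ [/= -> [b Ppb]].
  apply/ler_addgt0Pr => e e0; rewrite add0r.
  have -> : (inner p d <= e) = (inner p @^-1` [set r | r <= e]) d :> Prop by [].
  apply: hd.
    apply: closed_comp; last exact: closed_le.
    by move=> x _; exact: inner_continuousr.
  near=> n; rewrite /= innerZr mulrC ler_pdivrMr//.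
  apply: le_trans ((hu n).1 p b Ppb) _.
  apply: le_trans (_ : e * n%:R <= _); last first.
    by rewrite ler_wpM2l ?ltW// (hu n).2.
  rewrite mulrC -ler_pdivrMr//.
  by near: n; exact: nbhs_infty_ger.
by move=> d0; move: d1; rewrite d0 normr0 => /eqP; rewrite eq_sym oner_eq0.
Unshelve. all: end_near. Qed.

End Convexity.

(** * Minty's theorem by concave maximization *)

Section Minty.
Context {R : realType} {H : finDimHilbertType R}.
Implicit Types (x y : H) (G : set (H * H)).

Let half_diff (q : H * H * R) : H := 2^-1 *: (q.1.1 - q.1.2).

(** Between two lifted points [(y, y', <y, y'>)] this is the monotonicity product of their
    differences, but it is affine in each argument. *)
Let coupling (p q : H * H * R) : R :=
  p.2 + q.2 - inner p.1.1 q.1.2 - inner q.1.1 p.1.2.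

Let seg (t : R) (p q : H * H * R) : H * H * R :=
  (p.1.1 + t *: (q.1.1 - p.1.1), p.1.2 + t *: (q.1.2 - p.1.2),
   p.2 + t * (q.2 - p.2)).

Let coupling_seg t r p q :
  coupling r (seg t p q) = (1 - t) * coupling r p + t * coupling r q.
Proof. rewrite /coupling /seg /= !innerE; ring. Qed.

(* C is a bipolar: C1 collects the triples coupled nonnegatively with the
   lifted graph, C those coupled nonnegatively with all of C1.  Monotonicity
   puts the lifted graph in C1, hence C in C1, and then [coupling q q >= 0]
   on C is the last claim. *)
Lemma monotone_convex_hull G :
  (forall p q, G p -> G q -> 0 <= inner (p.2 - q.2) (p.1 - q.1)) ->
  exists C : set (H * H * R),
    [/\ forall p, G p -> C (p, inner p.1 p.2),
        forall t p q, 0 <= t -> t <= 1 -> C p -> C q -> C (seg t p q) &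
        forall q, C q -> inner q.1.1 q.1.2 <= q.2].
Proof.
move=> mG.
pose C1 := [set q | forall p, G p -> 0 <= coupling (p, inner p.1 p.2) q].
pose C2 := [set q | forall p, C1 p -> 0 <= coupling p q].
have GC1 p : G p -> C1 (p, inner p.1 p.2).
  move=> Gp q Gq; have := mG _ _ Gp Gq; rewrite /coupling /= !innerE.
  rewrite (innerC p.2) (innerC q.2) (innerC p.2) (innerC q.2); lra.
exists C2; split.
- move=> p Gp q C1q; have := C1q p Gp; rewrite /coupling /=; lra.
- move=> t p q t0 t1 Cp Cq r Cr; rewrite coupling_seg.
  by rewrite addr_ge0// mulr_ge0 ?Cp ?Cq// subr_ge0.
- move=> q Cq.
  have : C1 q by move=> p Gp; exact: Cq (GC1 _ Gp).
  move/(Cq q); rewrite /coupling; lra.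
Qed.

(** At the lift of [p] this is [<x + p.2, x - p.1>]; [half_diff q] minimizes it in [x]. *)
Let phi (q : H * H * R) x := inner x x - 2 * inner x (half_diff q) - q.2.

(** The point [x] is a cluster point of [half_diff] along a maximizing sequence of [f]: a
    near-maximizer gains little by moving towards any [q], which in the limit forces
    [phi q x <= 0]. *)
Lemma minty0 G :
  (forall p q, G p -> G q -> 0 <= inner (p.2 - q.2) (p.1 - q.1)) ->
  exists x, forall p, G p -> 0 <= inner (- x - p.2) (x - p.1).
Proof.
move=> mG.
have [[p0 Gp0]|G0] := pselect (G !=set0); last first.
  by exists 0 => p Gp; exfalso; apply: G0; exists p.
have [C [GC Cseg Cle]] := monotone_convex_hull mG.
suff [x hx] : exists x, forall q, C q -> phi q x <= 0.
  exists x => p Gp; have := hx _ (GC p Gp).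
  rewrite /phi /half_diff /= !innerE (innerC p.1 p.2) (innerC x p.2); lra.
(* [f q] is the minimum over x of [phi q x]. *)
pose f q := - q.2 - inner (half_diff q) (half_diff q).
(* Since [<y, y'> <= c] on [C], [f q] is at most [- |y + y'|^2 / 4]. *)
have f_le0 q : C q -> f q <= 0.
  move=> /Cle; have := inner_ge0 (2^-1 *: (q.1.1 + q.1.2)).
  rewrite /f /half_diff !innerE (innerC q.1.2 q.1.1); lra.
have hsE : has_sup (f @` C).
  split.
    exists (f (p0, inner p0.1 p0.2)), (p0, inner p0.1 p0.2) => //.
    exact: GC.
  by exists 0 => _ [q Cq <-]; exact: f_le0.
(* The tolerance [t n ^+ 2] is the square of the step, so dividing by [t n] leaves a vanishing
   error; the shift by 2 gives [t n <= 1/2]. *)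
pose t n : R := n.+2%:R^-1.
have t0 n : 0 < t n by rewrite invr_gt0.
have t12 n : t n <= 2^-1 by rewrite lef_pV2 ?posrE// ler_nat.
have /choice[u hu] n : exists q, C q /\ sup (f @` C) - t n ^+ 2 < f q.
  have [|_ [q Cq <-] hq] := sup_adherent _ hsE (eps := t n ^+ 2).
    by rewrite exprn_gt0.
  by exists q.
pose v n := half_diff (u n).
(* Near-optimality of [u n] along the segment towards [q]. *)
have key q n : C q ->
    inner (v n - half_diff q) (v n - half_diff q) <=
    inner (half_diff q) (half_diff q) + q.2 +
    t n * (1 + inner (v n - half_diff q) (v n - half_diff q)).
  move=> Cq; have [Cu fu] := hu n.
  have Cs : C (seg (t n) (u n) q).
    by apply: Cseg => //; [exact: ltW|have := t12 n; lra].
  have : f (seg (t n) (u n) q) <= sup (f @` C).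
    by apply: sup_upper_bound => //; exists (seg (t n) (u n) q).
  have := f_le0 _ Cu; move: fu.
  (* Exact expansion of the quadratic [f] along the segment. *)
  have -> : f (seg (t n) (u n) q) = f (u n) + t n * (phi q (v n) - f (u n))
      - t n ^+ 2 * inner (v n - half_diff q) (v n - half_diff q).
    rewrite /f /phi /v /half_diff /seg /= !innerE.
    rewrite (innerC q.1.2 q.1.1) (innerC (u n).1.2 (u n).1.1).
    rewrite (innerC q.1.1 (u n).1.1) (innerC q.1.2 (u n).1.1).
    rewrite (innerC q.1.1 (u n).1.2) (innerC q.1.2 (u n).1.2).
    ring.
  have -> : inner (v n - half_diff q) (v n - half_diff q) =
      phi q (v n) + inner (half_diff q) (half_diff q) + q.2.
    rewrite /phi; move: (half_diff q) (v n) => a b.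
    rewrite !innerE (innerC a b); ring.
  have := t0 n; move: (t n) (f (u n)) (phi q (v n)) (sup _) => s a b c.
  set k := inner _ _ => s0 h1 h2 h3.
  (* One factor [s] is cancelled, then [a = f (u n) <= 0] is dropped. *)
  have : 0 < s * (s * (1 + (b + k + q.2)) - b + a) by nra.
  rewrite pmulr_rgt0//; lra.
have [M vM] : exists M, forall n, `|v n| <= M.
  pose q0 : H * H * R := (p0, inner p0.1 p0.2).
  pose k0 := inner (half_diff q0) (half_diff q0) + q0.2.
  exists (`|half_diff q0| + (1 + (2 * k0 + 1))) => n.
  rewrite -[v n](subrKC (half_diff q0)) (le_trans (ler_normD _ _))// lerD2l.
  have := key q0 n (GC _ Gp0); rewrite inner_norm -/k0.
  have := t12 n; have := t0 n; have := normr_ge0 (v n - half_diff q0).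
  move: `|_| k0 (t n) => s k a s0 a0 a12 h.
  (* As [t n <= 1/2], half of [s ^+ 2] is absorbed on the left. *)
  have : a * (1 + s ^+ 2) <= 2^-1 * (1 + s ^+ 2).
    by rewrite ler_wpM2r// addr_ge0 ?sqr_ge0.
  have := sqr_ge0 (s - 1); nra.
have [x hx] := bounded_seq_cluster vM.
exists x => q Cq.
pose r y := inner (y - half_diff q) (y - half_diff q).
have r_continuous : continuous r.
  have -> : r = (fun s : R => s ^+ 2) \o Num.norm \o (fun y => y - half_diff q).
    by apply/funext => y; rewrite /r inner_norm.
  move=> y; apply: continuous_comp.
    by apply: continuousB; [exact: cvg_id|exact: cvg_cst].
  by apply: continuous_comp; [exact: norm_continuous|exact: exprn_continuous].
(* This is [phi q x <= 0] with the square completed, and the limit of [key]. *)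
suff : r x <= inner (half_diff q) (half_diff q) + q.2.
  rewrite /r /phi; move: (half_diff q) => a.
  rewrite !innerE (innerC a x); lra.
apply/ler_addgt0Pr => e e0.
apply: (hx (r @^-1` [set s | s <= _])).
  by apply: closed_comp => [y _|]; [exact: r_continuous|exact: closed_le].
pose L := M + `|half_diff q|.
have rL n : r (v n) <= L ^+ 2.
  rewrite /r inner_norm lerXn2r ?nnegrE//.
    by rewrite (le_trans (normr_ge0 _) (_ : `|v n| <= _))// ler_wpDr.
  by rewrite (le_trans (ler_normB _ _))// lerD2r.
near=> n; rewrite /= (le_trans (key q n Cq))// lerD2l.
rewrite -/(r (v n)) (le_trans (_ : _ <= t n * (1 + L ^+ 2)))//.
  by rewrite ler_wpM2l ?(ltW (t0 n))// lerD2l.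
rewrite mulrC ler_pdivrMr// mulrC -ler_pdivrMr//.
apply: le_trans (_ : n%:R <= _); last first.
  by rewrite ler_nat; apply: leqW; exact: leqnSn.
by near: n; exact: nbhs_infty_ger.
Unshelve. all: end_near. Qed.

End Minty.

(** * Resolvents and the closure of the domain *)

Section MaximalMonotone.
Context {R : realType} {H : finDimHilbertType R}.
Implicit Types (x y u v : H) (F : H -> set H).

(** Adjoining to [F] one pair monotonically related to its graph keeps it monotone, so maximality
    absorbs that pair. *)
Lemma maximal_monotoneP F : maximal_monotone F <-> Defs.monotone F /\
  forall x u, (forall y v, F y v -> 0 <= inner (u - v) (x - y)) -> F x u.
Proof.
split=> -[mF maxF]; split=> //.
  move=> x u rel.
  pose G y := F y `|` [set v | y = x /\ v = u].
  have mG : Defs.monotone G.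
    move=> y z v w [Fv|[-> ->]] [Fw|[-> ->]].
    - exact: mF.
    - by rewrite -(opprB u) -(opprB x) innerNl innerNr opprK; exact: rel.
    - exact: rel.
    - by rewrite !subrr inner0r.
  have -> : F x u = gph F (x, u) by [].
  by rewrite -(maxF _ mG) => [|[y v] Fv]; [right|left].
move=> G mG FG; apply/seteqP; split=> // -[x u] Gu.
by apply: maxF => y v /(FG (y, v)) Gv; exact: mG.
Qed.

(** [minty0] is applied to the graph of [l F - w]. *)
Lemma monotone_resolvent F (l : R) (w : H) : maximal_monotone F -> 0 < l ->
  exists z, F z (l^-1 *: (w - z)).
Proof.
move=> /maximal_monotoneP[mF maxF] l0.
pose G := [set p : H * H | exists2 v, F p.1 v & p.2 = l *: v - w].
have [|z hz] := @minty0 R H G.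
  move=> [y _] [y' _] [v /= Fv ->] [v' /= Fv' ->].
  rewrite /= opprB addrA subrK -scalerBr innerZl mulr_ge0 ?(ltW l0)//.
  exact: mF.
exists z; apply: maxF => y v Fv.
have := hz (y, l *: v - w) (ex_intro2 _ _ v Fv erefl).
have -> : - z - (l *: v - w) = l *: (l^-1 *: (w - z) - v).
  by rewrite scalerBr scalerA divff ?gt_eqF// scale1r opprB addrCA addrA.
by rewrite innerZl pmulr_rge0.
Qed.

(** The resolvent [z] of a convex combination [x] lies in the domain; averaging monotonicity against
    the two endpoints bounds [|x - z|^2] by a multiple of [l]. *)
Lemma closure_dom_convex F : maximal_monotone F ->
  convex_set (closure (dom F)).
Proof.
move=> mmF; have [mF _] := mmF.
apply: closure_convex => y0 y1 t t0 t1 [v0 Fv0] [v1 Fv1].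
set x := _ + _; apply/closure_ballP => e e0.
pose c := t * inner v0 (y0 - x) + (1 - t) * inner v1 (y1 - x).
pose d := t *: v0 + (1 - t) *: v1.
(* The estimates below give [|x - z|^2 <= 2 l c + l^2 |d|^2]. The term [e ^+ 2] ensures [l <= 1], so
   this is less than [l * B = e ^+ 2]. *)
pose B := 2 * `|c| + inner d d + 1 + e ^+ 2.
have B0 : 0 < B.
  by rewrite ltr_wpDl ?exprn_gt0// !addr_ge0 ?mulr_ge0 ?inner_ge0.
pose l := e ^+ 2 / B.
have l0 : 0 < l by rewrite divr_gt0// exprn_gt0.
have l1 : l <= 1.
  rewrite ler_pdivrMr// mul1r lerDr !addr_ge0 ?mulr_ge0 ?inner_ge0//.
have [z Fz] := monotone_resolvent x mmF l0.
exists z; first by eexists; exact: Fz.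
have h : inner (x - z) (x - z) <= l * (c + inner d (x - z)).
  have -> : inner (x - z) (x - z) = l * inner (l^-1 *: (x - z)) (x - z).
    by rewrite innerZl mulVKf// gt_eqF.
  rewrite ler_pM2l//.
  have := ler_wpM2l t0 (mF _ _ _ _ Fz Fv0).
  have := ler_wpM2l (etrans (subr_ge0 _ _) t1) (mF _ _ _ _ Fz Fv1).
  move: (l^-1 *: _) => w; rewrite /c /d /x !innerE; lra.
have := inner_ge0 (x - z - l *: d).
rewrite (innerDl (x - z)) !(innerDr _ (x - z)) !innerNl !innerNr.
rewrite !innerZl !innerZr (innerC (x - z) d) => h'.
have lt_e2 : inner (x - z) (x - z) < e ^+ 2.
  have -> : e ^+ 2 = l * B by rewrite /l divfK// gt_eqF.
  have : l * (l * inner d d) <= l * inner d d.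
    by rewrite ler_wpM2l ?(ltW l0)// ler_piMl ?inner_ge0.
  have : l * c <= l * `|c| by rewrite ler_wpM2l ?(ltW l0)// ler_norm.
  have : 0 < l * (1 + e ^+ 2) by rewrite mulr_gt0// ltr_wpDr ?sqr_ge0.
  rewrite /B; lra.
by rewrite inner_norm ltr_sqr ?nnegrE// ltW in lt_e2.
Qed.

End MaximalMonotone.

(** * The partial inverse, completion fibers and the cone [K] *)

Section Splitting.
Context {R : realType} {H : finDimHilbertType R}.
Context (Hs Hss : {vspace H}) (HD : orthogonal_decomposition Hs Hss).
Implicit Types (x y u v : H) (T : H -> set H).

Lemma orthogonal_split z :
  exists zs zss, [/\ zs \in Hs, zss \in Hss & z = zs + zss].
Proof.
have : z \in (Hs + Hss)%VS by rewrite HD.1 memvf.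
by case/memv_addP => zs zsH [zss zssH ->]; exists zs, zss.
Qed.

Lemma inner_cross x y : x \in Hs -> y \in Hss -> inner x y = 0.
Proof. exact: HD.2. Qed.

(** By orthogonality both sides equal [<ys, xs> + <yss, xss>]. *)
Lemma inner_exchange xs xss ys yss :
  xs \in Hs -> ys \in Hs -> xss \in Hss -> yss \in Hss ->
  inner (ys + xss) (xs + yss) = inner (ys + yss) (xs + xss).
Proof.
move=> xsH ysH xssH yssH; rewrite !innerE (innerC xss xs) (innerC yss xs).
rewrite (innerC xss yss) (inner_cross xsH xssH) (inner_cross xsH yssH).
by rewrite (inner_cross ysH xssH) (inner_cross ysH yssH) !(addr0, add0r).
Qed.

(** Testing with the [Hs]-component of [q] itself kills that component. *)
Lemma mem_complement q : (forall x, x \in Hs -> inner x q <= 0) -> q \in Hss.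
Proof.
move=> hq; have [qs [qss [qsH qssH eq_q]]] := orthogonal_split q.
have : qs = 0.
  apply: inner_eq0; have := hq qs qsH.
  by rewrite eq_q innerDr (inner_cross qsH qssH) addr0.
by move=> qs0; rewrite eq_q qs0 add0r.
Qed.

Lemma maximal_monotone_partial_inverse T :
  maximal_monotone T -> maximal_monotone (partial_inverse Hs Hss T).
Proof.
move=> /maximal_monotoneP[mT maxT]; apply/maximal_monotoneP; split.
  move=> x y u v [xs [us [xss [uss [[xsH usH xssH ussH] [-> -> Tx]]]]]].
  move=> [ys [vs [yss [vss [[ysH vsH yssH vssH] [-> -> Ty]]]]]].
  have := mT _ _ _ _ Tx Ty; rewrite !opprD !(addrACA _ _ (- _)).
  by rewrite -inner_exchange ?memvB.
move=> x u rel.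
have [xs [xss [xsH xssH xE]]] := orthogonal_split x.
have [us [uss [usH ussH uE]]] := orthogonal_split u.
exists xs, us, uss, xss; split=> //; split=> //.
apply: maxT => y v Tyv.
have [ys [yss [ysH yssH yE]]] := orthogonal_split y.
have [vs [vss [vsH vssH vE]]] := orthogonal_split v.
have := rel (ys + vss) (vs + yss).
rewrite xE uE yE vE !opprD !(addrACA _ _ (- _)) inner_exchange ?memvB//.
apply; exists ys, vs, yss, vss; split=> //; split=> //.
by rewrite -yE -vE.
Qed.

Context (T : H -> set H) (mmT : maximal_monotone T).

Let D := closure (dom (partial_inverse Hs Hss T)).
Let K : set H := [set q | q \in Hss /\ forall y, D y -> inner q y <= 0].

(* The first kind of constraint says that q is in Hss, the second that
   (zs + q, ws) is monotonically related to the graph of T. *)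
Definition completion_constraints (zs ws : H) : set (H * R) :=
  [set pb | pb.1 \in Hs /\ pb.2 = 0 \/
    exists2 ab : H * H, T ab.1 ab.2 &
      pb.1 = ab.2 - ws /\ pb.2 = inner (ab.2 - ws) (ab.1 - zs)].

(** With [zs] and [ws] fixed, being monotonically related to a point of the graph is an affine
    inequality in [q]. *)
Lemma completionE zs ws : zs \in Hs -> ws \in Hs ->
  completion Hs Hss T zs ws = halfspaces (completion_constraints zs ws).
Proof.
move=> zsH wsH; have [mT maxT] := (maximal_monotoneP _).1 mmT.
apply/seteqP; split=> q.
  move=> [_ _ qH Tq] p b [[/= pH ->]|[[a c] /= Tac [-> ->]]].
    by rewrite inner_cross.
  have := mT _ _ _ _ Tq Tac; rewrite !innerE; lra.
move=> hq; split=> //.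
  by apply: mem_complement => x xH; apply: hq; left.
apply: maxT => a c Tac.
have : inner (c - ws) q <= inner (c - ws) (a - zs).
  by apply: hq; right; exists (a, c).
rewrite !innerE; lra.
Qed.

(** For [d] in [Hss], [<c - ws, d>] sees only the [Hss]-component [c2] of [c], so [ws] drops out;
    the points [a1 + c2] are exactly the domain of the partial inverse. *)
Lemma recession_completion_constraints zs ws : ws \in Hs ->
  halfspaces (homogenize (completion_constraints zs ws)) = K.
Proof.
move=> wsH; apply/seteqP; split=> d.
  move=> hd.
  have dH : d \in Hss.
    by apply: mem_complement => x xH; apply: hd; split=> //; exists 0; left.
  split=> // y Dy.
  (* A closed half-space contains [D] once it contains the domain. *)
  have clD : halfspaces [set (d, 0)] y.
    suff /closure_subset :
        dom (partial_inverse Hs Hss T) `<=` halfspaces [set (d, 0)].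
      by move/(_ y Dy); rewrite -(closure_id _).1//; exact: closed_halfspaces.
    move=> _ [_ [ys [vs [yss [vss [[ysH vsH yssH vssH] [-> _ Ty]]]]]]].
    move=> _ _ [-> ->].
    have : inner (vs + vss - ws) d <= 0.
      apply: hd; split=> //=; eexists; right.
      by exists (ys + yss, vs + vss).
    rewrite addrAC innerDl (inner_cross (memvB vsH wsH) dH) add0r.
    by rewrite innerDr (innerC d ys) (inner_cross ysH dH) add0r innerC.
  exact: clD.
move=> [dH hd] p _ [/= -> [b [[/= pH _]|[[a c] /= Tac [-> _]]]]].
  by rewrite inner_cross.
have [a1 [a2 [a1H a2H aE]]] := orthogonal_split a.
have [c1 [c2 [c1H c2H cE]]] := orthogonal_split c.
have : inner d (a1 + c2) <= 0.
  apply: hd; apply: subset_closure; exists (c1 + a2), a1, c1, a2, c2.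
  by split=> //; split=> //; rewrite -aE -cE.
rewrite cE addrAC innerDl (inner_cross (memvB c1H wsH) dH) add0r.
by rewrite innerDr (innerC d a1) (inner_cross a1H dH) add0r innerC.
Qed.

Lemma polar_halfspaces :
  K = halfspaces [set pb | pb.2 = 0 /\ (pb.1 \in Hs \/ D pb.1)].
Proof.
apply/seteqP; split=> q.
  move=> [qH hq] p b [/= -> [pH|Dp]]; first by rewrite inner_cross.
  by rewrite innerC hq.
move=> hq; split.
  by apply: mem_complement => x xH; apply: hq; split=> //; left.
by move=> y Dy; rewrite innerC; apply: hq; split=> //; right.
Qed.

End Splitting.

(** * Transfer of the half-space facts to all completion fibers *)

Theorem lemma3p5 (R : realType) (H : finDimHilbertType R)
    (Hs Hss : {vspace H}) (T : H -> set H) :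
  orthogonal_decomposition Hs Hss ->
  maximal_monotone T ->
  gph (projected Hs Hss T) !=set0 ->
  let D : set H := closure (dom (partial_inverse Hs Hss T)) in
  let K : set H :=
    [set q | q \in Hss /\ forall y, D y -> inner q y <= 0] in
  [/\ [/\ D !=set0, closed D & convex_set D],
      [/\ K !=set0, closed K, convex_set K & cone K],
      forall zs ws : H, gph (projected Hs Hss T) (zs, ws) ->
        let fiber := completion Hs Hss T zs ws in
        [/\ fiber !=set0, closed fiber, convex_set fiber,
            recession fiber = [set q | q \in Hss /\ normal_cone D zs q]
          & [set q | q \in Hss /\ normal_cone D zs q] = K],
      (exists zs ws : H, gph (projected Hs Hss T) (zs, ws) /\
         bounded_set (completion Hs Hss T zs ws)) <->
      (forall zs ws : H, gph (projected Hs Hss T) (zs, ws) ->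
         bounded_set (completion Hs Hss T zs ws))
    & (exists zs ws : H, gph (projected Hs Hss T) (zs, ws) /\
         bounded_set (completion Hs Hss T zs ws)) ->
      forall zs ws : H, gph (projected Hs Hss T) (zs, ws) ->
        compact (completion Hs Hss T zs ws)].
Proof.
move=> HD mmT [[zs0 ws0] gph0] D K.
have domD zs ws : gph (projected Hs Hss T) (zs, ws) -> D zs.
  move=> [/= zsH wsH [zss zssH Tz]]; apply: subset_closure.
  (* The pair [(ws, 0)] has zero [Hss]-part, so the partial inverse is evaluated at [zs] itself. *)
  exists (ws + zss), zs, ws, zss, 0.
  by rewrite !addr0 mem0v.
have fiber0 zs ws : gph (projected Hs Hss T) (zs, ws) ->
    completion Hs Hss T zs ws !=set0.
  by move=> [/= zsH wsH [zss zssH Tz]]; exists zss.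
have fiberE zs ws : gph (projected Hs Hss T) (zs, ws) ->
    completion Hs Hss T zs ws = halfspaces (completion_constraints Hs T zs ws).
  by move=> [/= zsH wsH _]; exact: completionE.
have rec_fiber zs ws : gph (projected Hs Hss T) (zs, ws) ->
    recession (completion Hs Hss T zs ws) = K.
  move=> gzw; have := fiber0 _ _ gzw; rewrite fiberE// => ne.
  rewrite recession_halfspaces//.
  by have [_ wsH _] := gzw; exact: recession_completion_constraints.
(* The criterion involves only [K], so boundedness passes between fibers. *)
have bounded_fiberP zs ws : gph (projected Hs Hss T) (zs, ws) ->
    bounded_set (completion Hs Hss T zs ws) <-> K `<=` [set 0].
  move=> gzw; rewrite -(rec_fiber _ _ gzw).
  have := fiber0 _ _ gzw; rewrite fiberE//; exact: bounded_halfspacesP.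
have bounded_all : (exists zs ws : H, gph (projected Hs Hss T) (zs, ws) /\
     bounded_set (completion Hs Hss T zs ws)) ->
    forall zs ws : H, gph (projected Hs Hss T) (zs, ws) ->
     bounded_set (completion Hs Hss T zs ws).
  move=> [zs [ws [gzw /(bounded_fiberP _ _ gzw)K0]]] zs' ws' gzw'.
  exact/bounded_fiberP.
have K_halfspaces : K = halfspaces _ := polar_halfspaces HD T.
split.
- split; [by exists zs0; exact: domD gph0|exact: closed_closure|].
  exact/closure_dom_convex/maximal_monotone_partial_inverse.
- split.
  + by exists 0; split=> [|y _]; [exact: mem0v|rewrite innerC inner0r].
  + by rewrite K_halfspaces; exact: closed_halfspaces.
  + by rewrite K_halfspaces; exact: convex_halfspaces.
  + move=> t q t0 [qH hq]; split; first exact: memvZ.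
    by move=> y Dy; rewrite innerZl mulr_ge0_le0// hq.
- move=> zs ws gzw fiber.
  (* As [q] is orthogonal to [zs], the base point drops out of the normal cone inequality. *)
  have normalE : [set q | q \in Hss /\ normal_cone D zs q] = K.
    have [zsH _ _] := gzw.
    apply/seteqP; split=> q [qH] => [[_ hq]|hq]; split=> //.
      move=> y Dy; have := hq y Dy.
      by rewrite innerDr innerNr (innerC q zs) (HD.2 _ _ zsH qH) subr0.
    split; first exact: domD gzw.
    move=> y Dy; rewrite innerDr innerNr (innerC q zs) (HD.2 _ _ zsH qH) subr0.
    exact: hq.
  split=> //; first exact: fiber0.
  + by rewrite /fiber fiberE//; exact: closed_halfspaces.
  + by rewrite /fiber fiberE//; exact: convex_halfspaces.
  + by rewrite normalE; exact: rec_fiber.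
(* The existence of some fiber comes from the nonempty graph. *)
- split=> // bd; exists zs0, ws0; split=> //; exact: bd.
- move=> ex zs ws gzw; apply: bounded_closed_compact_hilbert.
    exact: bounded_all.
  by rewrite fiberE//; exact: closed_halfspaces.
Qed.
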